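(* Let $c \ge 1$ be a fixed constant. There is a one-pass randomized streaming algorithm for $\mathrm{DYCK}(2)$ with space $O(\sqrt{n}\,\log n)$ and time $\mathrm{polylog}(n)$ on input streams of length $n$, with the following guarantee: if the input stream $x \in \{a,\bar a,b,\bar b\}^n$ belongs to $\mathrm{DYCK}(2)$, then the algorithm accepts $x$ with probability $1$; otherwise it rejects $x$ with probability at least $1-n^{-c}$.
   Context: $\mathrm{DYCK}(2)$ is the language of well-parenthesized words with two types of parentheses: over the alphabet $\{a,\bar a,b,\bar b\}$ it is the smallest language $L$ satisfying $L=\{\epsilon\}\cup aL\bar aL\cup bL\bar bL$ ($a,b$ are opening parentheses, and $\bar a,\bar b$ the respective closing ones). $\mathrm{DYCK}(2)$ also denotes the problem of deciding whether a given word is in the language. A $k$-pass streaming algorithm with space $s(n)$ and time $t(n)$ is an algorithm such that for every input stream $x=x_1x_2\ldots x_n$: (1) it performs $k$ sequential passes over $x$, the letters arriving one by one in the order $x_1,x_2,\ldots,x_n$; (2) it maintains a memory of size $s(n)$ bits while reading $x$; (3) it has running time at most $t(n)$ per letter $x_i$; (4) it has preprocessing and postprocessing time $t(n)$. Standing assumptions: the length $n$ is given to the algorithm in advance. The algorithm has access to a prime $p$ with $n^{1+c}\le p<2n^{1+c}$ and to a uniformly random integer $\alpha\in[0,p-1]$ (used for hashing); the probabilities are over the choice of $\alpha$. *)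

(* Defs.v *)
From mathcomp Require Export all_boot all_order all_algebra.
From mathcomp Require Export all_classical all_reals all_analysis.

Set Implicit Arguments.
Unset Strict Implicit.
Unset Printing Implicit Defensive.

Export Order.TTheory GRing.Theory Num.Theory.
Export numFieldNormedType.Exports.

Inductive letter := La | La_bar | Lb | Lb_bar.

Inductive dyck2 : seq letter -> Prop :=
| dyck2_nil : dyck2 [::]
| dyck2_a u v : dyck2 u -> dyck2 v -> dyck2 (La :: u ++ La_bar :: v)
| dyck2_b u v : dyck2 u -> dyck2 v -> dyck2 (Lb :: u ++ Lb_bar :: v).

(* The model of computation is a random access machine with logarithmic cost:
   cells hold natural numbers of arbitrary size, and both time and space are
   counted in bits.  Programs are structured instead of being lists of jumps;
   since they are finite syntax not depending on the input length, algorithms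
   are uniform. *)

(* Cells beyond the end of the list are blank and read as 0; writing to one of
   them extends the list, so space is charged up to the highest cell ever
   written. *)
Definition mem := seq nat.

Definition get (m : mem) (i : nat) : nat := nth 0 m i.
Definition put (m : mem) (i v : nat) : mem := set_nth 0 m i v.

(* bitlen 0 = 1, so every cell is charged at least one bit. *)
Definition bitlen (v : nat) : nat := (trunc_log 2 v).+1.

Definition bits (m : mem) : nat := sumn [seq bitlen v | v <- m].

Inductive binop := Add | Sub | Mul | Div | Mod.

(* Sub is truncated at 0; x %/ 0 = 0 and x %% 0 = x. *)
Definition binop_fun (o : binop) : nat -> nat -> nat :=
  match o with
  | Add => addn | Sub => subn | Mul => muln | Div => divn | Mod => modn
  end.

(* Schoolbook bit complexity. *)
Definition binop_cost (o : binop) (x y : nat) : nat :=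
  match o with
  | Add | Sub => bitlen x + bitlen y
  | Mul | Div | Mod => bitlen x * bitlen y
  end.

Inductive instr :=
| Lit (d k : nat)               (* M[d] := k *)
| Bin (o : binop) (d i j : nat) (* M[d] := M[i] o M[j] *)
| Fetch (d i : nat)              (* M[d] := M[M[i]] *)
| Store (d i : nat).            (* M[M[d]] := M[i] *)

Definition effect (c : instr) (m : mem) : mem :=
  match c with
  | Lit d k => put m d k
  | Bin o d i j => put m d (binop_fun o (get m i) (get m j))
  | Fetch d i => put m d (get m (get m i))
  | Store d i => put m (get m d) (get m i)
  end.

(* The addresses d, i, j written in the program are constants of the program
   and are not charged; addresses computed at run time are. *)
Definition cost (c : instr) (m : mem) : nat :=
  match c with
  | Lit d k => bitlen k
  | Bin o d i j => binop_cost o (get m i) (get m j)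
  | Fetch d i => bitlen (get m i) + bitlen (get m (get m i))
  | Store d i => bitlen (get m d) + bitlen (get m i)
  end.

Inductive prog :=
| Skip
| Instr (c : instr)
| Seq (c1 c2 : prog)
| If (i : nat) (c1 c2 : prog)   (* tests M[i] <> 0 *)
| While (i : nat) (c : prog).   (* loops as long as M[i] <> 0 *)

(* exec S c m t m': started on memory m, program c halts with memory m' after
   t bit operations, and the memory occupies at most S bits at every moment of
   the computation, both ends included. *)
Inductive exec (S : nat) : prog -> mem -> nat -> mem -> Prop :=
| ExSkip m : bits m <= S -> exec S Skip m 0 m
| ExInstr c m : bits m <= S -> bits (effect c m) <= S ->
    exec S (Instr c) m (cost c m) (effect c m)
| ExSeq c1 c2 m t1 m1 t2 m2 : exec S c1 m t1 m1 -> exec S c2 m1 t2 m2 ->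
    exec S (Seq c1 c2) m (t1 + t2) m2
| ExIfT i c1 c2 m t m' : get m i != 0 -> exec S c1 m t m' ->
    exec S (If i c1 c2) m (bitlen (get m i) + t) m'
| ExIfF i c1 c2 m t m' : get m i == 0 -> exec S c2 m t m' ->
    exec S (If i c1 c2) m (bitlen (get m i) + t) m'
| ExWhileT i c m t1 m1 t2 m2 : get m i != 0 ->
    exec S c m t1 m1 -> exec S (While i c) m1 t2 m2 ->
    exec S (While i c) m (bitlen (get m i) + t1 + t2) m2
| ExWhileF i c m : get m i == 0 -> bits m <= S ->
    exec S (While i c) m (bitlen (get m i)) m.

Record algorithm := Algorithm {
  preprocess : prog;
  process_letter : prog;
  postprocess : prog }.

Definition code (l : letter) : nat :=
  match l with La => 0 | La_bar => 1 | Lb => 2 | Lb_bar => 3 end.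

(* An arriving letter is delivered in cell 0, and process_letter is then run
   within T bit operations. *)
Inductive read_stream (A : algorithm) (S T : nat) :
    mem -> seq letter -> mem -> Prop :=
| ReadNil m : read_stream A S T m [::] m
| ReadCons m l t m1 w m2 :
    exec S (process_letter A) (put m 0 (code l)) t m1 -> t <= T ->
    read_stream A S T m1 w m2 ->
    read_stream A S T m (l :: w) m2.

(* outcome A k S T n p alpha x v: with k passes over x, using at most S bits
   of memory and time at most T for the preprocessing, for each letter and for
   the postprocessing, A halts with verdict v (accept if v = true, reject if
   v = false).  The length n, the prime p and the random alpha are initially
   in cells 1, 2 and 3; the verdict is "cell 0 is nonzero". *)
Definition outcome (A : algorithm) (k S T n p alpha : nat) (x : seq letter)
    (v : bool) : Prop :=
  exists t0 m0 m1 t2 m2,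
    [/\ exec S (preprocess A) [:: 0; n; p; alpha] t0 m0 /\ t0 <= T,
        read_stream A S T m0 (flatten (nseq k x)) m1,
        exec S (postprocess A) m1 t2 m2 /\ t2 <= T
      & v = (get m2 0 != 0)].

Local Open Scope ring_scope.

(* Probability of E for alpha uniform in {0, ..., p - 1}. *)
Definition unif_prob (R : realType) (p : nat) (E : nat -> Prop) : R :=
  #|[set alpha : 'I_p | `[< E alpha >]]%SET|%:R / p%:R.

Definition good_prime (R : realType) (c : R) (n p : nat) : Prop :=
  prime p /\ n%:R `^ (1 + c) <= p%:R < 2 * n%:R `^ (1 + c).

Definition streaming_algorithm (R : realType) (c : R) (k : nat) (s t : nat -> nat)
    (A : algorithm) : Prop :=
  forall (n p alpha : nat) (x : seq letter),
    good_prime c n p -> (alpha < p)%N -> size x = n ->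
    exists v : bool, outcome A k (s n) (t n) n p alpha x v.

Local Open Scope classical_set_scope.

Definition polylog (R : realType) (t : nat -> nat) : Prop :=
  exists e : nat, (fun n => (t n)%:R : R) =O_\oo (fun n => ln (n%:R : R) ^+ e).

(* Main.v *)
(* The unmatched opening letters form a stack.  Its top part, at most B ~ sqrt n
   letters, is kept explicitly; whenever it reaches B letters it is compressed
   into an item that only stores a hash of them, so there are at most
   n / B <= B items.  A closing letter arriving when the explicit part is empty
   is absorbed by the top item: the word o of the B letters pushed and the word
   c of the closing letters read are compared, when c is complete, through the
   values at alpha of the polynomials over F_p with coefficients o and c.
   The hash of the opening letters, which arrive bottom first, is computed by
   Horner's rule, that of the closing ones with a running power of alpha.
   Until it first rejects, the algorithm behaves as if comparisons were exact,
   so only the first comparison of different words matters; it is wrong for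
   fewer than B <= n of the p values of alpha, and n / p <= n^-c. *)

Require Import Defs.
From mathcomp Require Import zify lra.

Set Implicit Arguments.
Unset Strict Implicit.
Unset Printing Implicit Defensive.

(** * Stacks and sketches *)

Definition closing (l : letter) : bool :=
  match l with La_bar | Lb_bar => true | _ => false end.
Definition kind (l : letter) : bool :=
  match l with Lb | Lb_bar => true | _ => false end.

Lemma code_kind l : code l %/ 2 = kind l.
Proof. by case: l. Qed.

Lemma code_closing l : code l %% 2 = closing l.
Proof. by case: l. Qed.

Fixpoint stack_accepts (s : seq bool) (w : seq letter) : bool :=
  match w with
  | [::] => nilp s
  | l :: w' =>
    if closing l then
      if s is y :: s' then (y == kind l) && stack_accepts s' w' else false
    else stack_accepts (kind l :: s) w'
  end.

Lemma dyck2_wrap x u v : dyck2 u -> dyck2 v ->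
  dyck2 ((if x then Lb else La) :: u ++ (if x then Lb_bar else La_bar) :: v).
Proof. by case: x => ? ?; constructor. Qed.

Lemma stack_accepts_dyck2 u s w :
  dyck2 u -> stack_accepts s (u ++ w) = stack_accepts s w.
Proof.
move=> du; elim: du s w => [|u1 u2 _ IH1 _ IH2|u1 u2 _ IH1 _ IH2] s w //=.
- by rewrite -catA cat_cons IH1 /= IH2.
- by rewrite -catA cat_cons IH1 /= IH2.
Qed.

(** The word is cut at the letter that pops the top of the initial stack; what precedes it is
    balanced. The bound [n] gives strong induction, since the hypothesis is also applied to the
    remainder [v]. *)
Lemma stack_accepts_split n s w : size w <= n -> stack_accepts s w ->
  if s is x :: s' then
    exists u v, [/\ w = u ++ (if x then Lb_bar else La_bar) :: v,
      dyck2 u & stack_accepts s' v]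
  else dyck2 w.
Proof.
elim: n s w => [|n IHn] s [|l w] //= Hw.
- by case: s => // _; constructor.
- by case: s => // _; constructor.
case Hl: (closing l).
  case: s => // x s' /andP[/eqP -> Hacc].
  exists [::], w; split=> //; last by constructor.
  by case: l Hl {Hw Hacc}.
move=> Hacc.
have [u [v [Ew du Hv]]] := IHn (kind l :: s) w Hw Hacc.
have Hvn : size v <= n by move: Hw; rewrite Ew size_cat /=; lia.
have El : l = if kind l then Lb else La by case: l Hl {Hacc Ew}.
case: s Hv {Hacc} => [|x s'] Hv.
  have dv := IHn [::] v Hvn Hv.
  by rewrite Ew El; case: (kind l); constructor.
have [u2 [v2 [Ev du2 Hv2]]] := IHn (x :: s') v Hvn Hv.
exists (l :: u ++ (if kind l then Lb_bar else La_bar) :: u2), v2.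
split=> //; first by rewrite Ew Ev /= -catA.
by rewrite {1}El; apply: dyck2_wrap.
Qed.

Lemma stack_acceptsP w : reflect (dyck2 w) (stack_accepts [::] w).
Proof.
apply: (iffP idP) => [|dw]; first exact: (@stack_accepts_split (size w) [::]).
by rewrite -(cats0 w) stack_accepts_dyck2.
Qed.

(* A sketch (es, its) stands for the stack of unmatched letters, top first:
   es is stored letter by letter, whereas an item (o, c) of its stands for a
   block o of B letters of which the top ones have been popped by the closing
   letters c without any comparison. *)
Definition sketch := (seq bool * seq (seq bool * seq bool))%type.

(** [test] is a parameter so that the same transitions run with [eq_op] and with [hash_test]. *)
Definition step (test : rel (seq bool)) (B : nat) (st : sketch) (l : letter) :
    option sketch :=
  let: (es, its) := st in
  if closing l then
    match es, its with
    | y :: es', _ => if y == kind l then Some (es', its) else None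
    | [::], [::] => None
    | [::], (o, c) :: its' =>
      let c' := rcons c (kind l) in
      if size c' < B then Some ([::], (o, c') :: its')
      else if test o c' then Some ([::], its') else None
    end
  else
    let es' := kind l :: es in
    if size es' < B then Some (es', its) else Some ([::], (es', [::]) :: its).

Definition run test B (st : option sketch) (w : seq letter) : option sketch :=
  foldl (fun st l => obind (fun s => step test B s l) st) st w.

Definition accepted (st : option sketch) : bool :=
  st == Some ([::], [::]).

Lemma run_None test B w : run test B None w = None.
Proof. by elim: w. Qed.

(** The inequalities are strict because a block reaching [B] letters is compressed, or compared,
    within the same step. *)
Definition well_sized B (st : sketch) : bool :=
  (size st.1 < B) && all (fun i => (size i.1 == B) && (size i.2 < B)) st.2.

Lemma step_well_sized test B st l st' : 0 < B ->
  well_sized B st -> step test B st l = Some st' -> well_sized B st'.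
Proof.
move=> B0; case: st => es its; rewrite /well_sized /step /=.
case: (closing l).
  case: es => [|y es] /=.
    case: its => [|[ o c] its] //= /and3P[_ /andP[/= Ho Hc] Hits].
    case: ifP => [Hs [ <-]|_] /=; first by rewrite B0 Ho Hs Hits.
    by case: ifP => // _ [ <-]; rewrite /= B0 Hits.
  case: ifP => // _ /andP[Hs Hits] [ <-] /=.
  by rewrite Hits andbT; lia.
move=> /andP[Hs Hits]; case: ifP => [Hs' [ <-]|Hs' [ <-]] /=.
  by rewrite Hs' Hits.
rewrite B0 Hits /= andbT; by move: Hs Hs' => /=; lia.
Qed.

Definition faithful (st : sketch) : bool :=
  all (fun i => i.2 == take (size i.2) i.1) st.2.

Definition stack_of (st : sketch) : seq bool :=
  st.1 ++ flatten [seq drop (size i.2) i.1 | i <- st.2].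

(** A wrong closing letter absorbed by an item is noticed only when the item is complete. Until then
    the sketch is not [faithful], and it is already lost, since an item leaves only by passing its
    comparison. *)
Lemma accepted_exact B st w : 0 < B -> well_sized B st ->
  accepted (run eq_op B (Some st) w) =
  faithful st && stack_accepts (stack_of st) w.
Proof.
move=> B0; elim: w st => [|l w IH] st wst.
  case: st wst => es its /=; rewrite /accepted /= /faithful /stack_of /=.
  rewrite /well_sized /=.
  case: es => [|y es] /=; last by rewrite andbF; case: eqP.
  case: its => [|[ o c] its] /=; first by rewrite eqxx.
  move=> /and3P[_ /andP[/= /eqP Ho Hc] _].
  rewrite [LHS](_ : _ = false); last by apply/eqP.
  (* As [size c < B = size o], the top item still holds a letter. *)
  apply/esym/negbTE; rewrite negb_and /nilp size_cat size_drop.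
  apply/orP; right; rewrite /=; lia.
rewrite /= -/(run _ _ _ _).
case E: (step eq_op B st l) => [st'|]; last first.
  rewrite run_None.
  apply/esym/negbTE/negP => /andP[Hf].
  move: E wst Hf; case: st => es its; rewrite /step /well_sized /faithful /stack_of /=.
  case: (closing l); last by case: ifP.
  case: es => [|y es] /=; last by case: eqP.
  case: its => [|[ o c] its] //=.
  rewrite size_rcons; case: ifP => // Hs.
  case: eqP => // oc _ /and3P[_ /andP[/= /eqP Ho Hc] _] /andP[/eqP Ec _].
  have Hso : size c < size o by rewrite Ho.
  (* Faithfulness and a matching last letter would make the completed [c] equal to [o]. *)
  rewrite (drop_nth false) //= => /andP[/eqP Hk _]; apply: oc.
  rewrite -Hk Ec size_take Hso -take_nth // take_oversize //.
  by rewrite Ho; lia.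
rewrite IH; last exact: step_well_sized E.
move: E wst; case: st => es its; rewrite /step /well_sized /faithful /stack_of /=.
case: (closing l) => /=.
  case: es => [|y es] /=; last first.
    by case: eqP => // _ [ <-].
  case: its => [|[ o c] its] //=.
  rewrite size_rcons => + /and3P[_ /andP[/= /eqP Ho Hc] _].
  have Hso : size c < size o by rewrite Ho.
  rewrite (drop_nth false) //=.
  (* The extended item is faithful exactly when the old one is and the letter passes the check made
     by [stack_accepts]. *)
  have Eq : (rcons c (kind l) == take (size c).+1 o) =
            (c == take (size c) o) && (nth false o (size c) == kind l).
    rewrite (take_nth false) // -!cats1 eqseq_cat ?size_take ?Hso // eqseq_cons andbT.
    by rewrite [kind l == _]eq_sym.
  case: ifP => [Hs [ <-]|Hs] /=.
    by rewrite size_rcons Eq -!andbA; do 2!bool_congr; rewrite andbCA.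
  have Eo : take (size c).+1 o = o by rewrite take_oversize // Ho; lia.
  have Ed : drop (size c).+1 o = [::] by rewrite drop_oversize // Ho; lia.
  rewrite Ed /=; rewrite Eo eq_sym in Eq.
  by rewrite Eq; case: ifP => // /andP[-> ->] [ <-].
by case: ifP => [_ [ <-]|_ [ <-]] //= _; rewrite ?drop0.
Qed.

(* Control flow depends on the comparisons only through failure, hence a
   single comparison decides whether an approximate test can go wrong. *)
Lemma rejected_witness B st w : 0 < B -> well_sized B st ->
  ~~ accepted (run eq_op B (Some st) w) ->
  exists o c, [/\ o != c, size o = B, size c = B &
    forall test : rel (seq bool), (forall s, test s s) -> ~~ test o c ->
      ~~ accepted (run test B (Some st) w)].
Proof.
move=> B0; elim: w st => [|l w IH] st wst.
  (* No comparison causes this rejection, so any two distinct words of length [B] serve. *)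
  move=> Hrej; exists (nseq B true), (nseq B false).
  rewrite !size_nseq; split=> //.
  by case: B B0 {wst Hrej}.
rewrite /= -!/(run _ _ _ _) => Hrej.
(* Either this step compares two different words, or every reflexive test acts here like [eq_op]. *)
have [[ o [c]] [oc Ho Hc Hst]|Hsame] : (exists o c, [/\ o != c, size o = B, size c = B &
    forall test : rel (seq bool), ~~ test o c -> step test B st l = None]) \/
    (forall test : rel (seq bool), (forall s, test s s) -> step test B st l = step eq_op B st l).
- case: st wst {Hrej IH} => es its; rewrite /well_sized /step /=.
  case: (closing l); last by right.
  case: es => [|y es]; last by right.
  case: its => [|[ o c] its] /=; first by right.
  move=> /and3P[_ /andP[/= /eqP Ho Hc] _].
  case: ltnP => Hs; first by right.
  have Hrs : size (rcons c (kind l)) = B.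
    by move: Hs; rewrite size_rcons; lia.
  case: eqP => [<-|oc]; first by right => test ->.
  left; exists o, (rcons c (kind l)); split=> //; first exact/eqP.
  by move=> test /negbTE ->.
- by exists o, c; split=> // test _ ntest; rewrite Hst // run_None.
case E: (step eq_op B st l) Hrej => [st'|] Hrej.
  have [ o [c [oc Ho Hc Hw]]] := IH st' (step_well_sized B0 wst E) Hrej.
  exists o, c; split=> // test tr nt.
  by rewrite /= -/(run _ _ _ _) Hsame // E; exact: Hw.
(* A mismatch with an explicit letter, or an empty stack, rejects under every reflexive test; the
   witness is again arbitrary. *)
exists (nseq B true), (nseq B false).
rewrite !size_nseq; split=> //; first by case: B B0 {wst Hsame E IH Hrej}.
by move=> test tr _; rewrite /= -/(run _ _ _ _) Hsame // E run_None.
Qed.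

(** A reflexive test passes every comparison that [eq_op] passes, so errors are one-sided. *)
Lemma accepted_complete (test : rel (seq bool)) B st w : (forall s, test s s) ->
  accepted (run eq_op B st w) -> accepted (run test B st w).
Proof.
move=> tr; suff H st0 : run eq_op B st0 w != None -> run test B st0 w = run eq_op B st0 w.
  by move=> Ha; rewrite H //; move: Ha; rewrite /accepted; case: (run _ _ _ _).
elim: w st0 => [|l w IH] st0 //=; rewrite -!/(run _ _ _ _) => Hn.
rewrite -IH //; congr run.
case: st0 Hn => [[es its]|] //=.
case: (closing l) => //; case: es => // ; case: its => [|[ o c] its] //=.
case: ifP => // _; case: (o =P _) => [<- _|_]; first by rewrite tr.
by rewrite run_None.
Qed.

(** * Hashing *)

Section Hash.
Variables p al : nat.
Hypothesis p2 : 1 < p.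

(** The head, which is the top letter, is the constant coefficient: pushing is a Horner step,
    whereas a closing letter appended to [c] adds a monomial of degree [size c]. *)
Fixpoint hash (s : seq bool) : nat :=
  if s is x :: s' then (hash s' * al + x) %% p else 0.

Definition hash_diff (o c : seq bool) : nat := (hash o + (p - hash c)) %% p.

Definition hash_test (o c : seq bool) : bool := hash o == hash c.

Lemma hash_lt s : hash s < p.
Proof. by case: s => [|x s] /=; [lia|rewrite ltn_pmod //; lia]. Qed.

Lemma hash_rcons c x : hash (rcons c x) = hash c + x * al ^ size c %[mod p].
Proof.
elim: c => [|y c IH] /=.
  by rewrite !mul0n !add0n muln1 modn_mod.
rewrite modn_mod modnDml -addnA (addnC (nat_of_bool y)) addnA.
rewrite -[LHS]modnDml -modnMml IH modnMml modnDml; congr (_ %% p).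
by rewrite mulnDl expnSr mulnA.
Qed.

Lemma hash_diffK o c : hash_diff o c + hash c = hash o %[mod p].
Proof.
have hc := hash_lt c; rewrite modnDml -addnA subnK; last exact: ltnW.
by rewrite modnDr.
Qed.

(** This is the update made by the machine, with [p - x] standing for the opposite of [x]. It is
    checked after adding [hash (rcons c x)] to both sides. *)
Lemma hash_diff_rcons o c (x : bool) :
  ((p - x) * (al ^ size c %% p) + hash_diff o c) %% p =
  hash_diff o (rcons c x).
Proof.
rewrite -[RHS](@modn_small _ p); last by rewrite ltn_pmod; lia.
apply/eqP; rewrite -(eqn_modDr (hash (rcons c x))) hash_diffK.
rewrite -modnDmr hash_rcons modnDmr -addnA -modnDml modnMmr modnDml.
set q := al ^ size c; set d := hash_diff o c.
have -> : (p - x) * q + (d + (hash c + x * q)) = q * p + (d + hash c).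
  have : x * q <= p * q by rewrite leq_mul2r; case: (x) => //; lia.
  rewrite mulnBl [q * p]mulnC; lia.
by rewrite modnMDl hash_diffK.
Qed.

Lemma hash_diff_nil o : hash_diff o [::] = hash o.
Proof. by rewrite /hash_diff subn0 modnDr modn_small ?hash_lt. Qed.

Lemma hash_diff_eq0 o c : (hash_diff o c == 0) = hash_test o c.
Proof.
rewrite /hash_diff /hash_test -/(dvdn _ _).
have ho := hash_lt o; have hc := hash_lt c.
apply/idP/eqP => [/dvdnP[k Ek]|->]; last by rewrite subnKC ?dvdnn // ltnW.
(* The sum lies strictly between [0] and [2 * p]. *)
have : k = 1 by nia.
by move=> Ek1; rewrite Ek1 in Ek; lia.
Qed.

(** 0 and 1 are distinct modulo [p], so checking an explicit letter through hashes never errs,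
    whatever [al] is. *)
Lemma hash_eq_cons x y s : (hash (x :: s) == hash (y :: s)) = (x == y).
Proof.
apply/idP/eqP => [|->//]; rewrite /= eqn_modDl.
by rewrite !modn_small; case: x; case: y => //; lia.
Qed.

End Hash.

(** * Costs on the machine *)

Arguments get : simpl never.
Arguments put : simpl never.

Section Machine.
Variables N V : nat.

Definition bounded (m : mem) : Prop :=
  size m <= N /\ forall i, get m i <= V.

Definition space := N * bitlen V.
(** The square comes from products and divisions, the factor 2 from instructions charged for two
    lengths. *)
Definition instr_time := 2 * bitlen V ^ 2.

Lemma leq_bitlen x y : x <= y -> bitlen x <= bitlen y.
Proof. by move=> xy; rewrite ltnS leq_trunc_log. Qed.

Lemma bits_bounded m : bounded m -> bits m <= space.
Proof.
move=> [Hs Hv]; apply: (@leq_trans (size m * bitlen V)); last exact: leq_mul.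
have {}Hv i : i \in m -> i <= V.
  by move=> /(nthP 0)[j _ <-]; exact: Hv.
rewrite /bits; elim: m Hv {Hs} => //= x m IH Hv; rewrite mulSn leq_add //.
  by apply/leq_bitlen/Hv; rewrite inE eqxx.
by apply: IH => i im; apply: Hv; rewrite inE im orbT.
Qed.

Lemma get_put m d v i : get (put m d v) i = if i == d then v else get m i.
Proof. by rewrite /get /put nth_set_nth /=. Qed.

Lemma get_put_neq m d v i : i != d -> get (put m d v) i = get m i.
Proof. by move=> id; rewrite get_put (negbTE id). Qed.

Definition target (c : instr) (m : mem) : nat :=
  match c with Lit d _ | Bin _ d _ _ | Fetch d _ => d | Store d _ => get m d end.

Definition result (c : instr) (m : mem) : nat :=
  match c with
  | Lit _ k => k
  | Bin o _ i j => binop_fun o (get m i) (get m j)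
  | Fetch _ i => get m (get m i)
  | Store _ i => get m i
  end.

Lemma effectE c m : effect c m = put m (target c m) (result c m).
Proof. by case: c. Qed.

Lemma bounded_put m d v : bounded m -> d < N -> v <= V -> bounded (put m d v).
Proof.
move=> [Hs Hv] dN vV; split; first by rewrite size_set_nth geq_max dN.
by move=> i; rewrite get_put; case: ifP.
Qed.

Lemma bitlen_time v : v <= V -> bitlen v <= bitlen V ^ 2.
Proof.
move=> /leq_bitlen Hv; apply: (leq_trans Hv).
by rewrite expnS expn1 leq_pmull.
Qed.

Lemma cost_bounded c m : bounded m -> result c m <= V -> cost c m <= instr_time.
Proof.
move=> [_ Hv] Hr; rewrite /instr_time mul2n -addnn.
case: c Hr => [d k|o d i j|d i|d i] /= Hr.
- by apply: leq_trans (bitlen_time Hr) _; rewrite leq_addr.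
- have bi := bitlen_time (Hv i); have bj := bitlen_time (Hv j).
  have Hm : bitlen (get m i) * bitlen (get m j) <= bitlen V ^ 2 + bitlen V ^ 2.
    apply: (@leq_trans (bitlen V ^ 2)); last exact: leq_addr.
    by rewrite expnS expn1 leq_mul // leq_bitlen.
  by case: o {Hr} => /=; try exact: Hm; rewrite leq_add.
- by rewrite leq_add // bitlen_time.
- by rewrite leq_add // bitlen_time.
Qed.

(** A weakest precondition for loop-free code. Each write must respect [N] and [V], which makes
    [bounded] an invariant; loops are excluded by [False] and treated by hand. *)
Fixpoint wp (c : prog) (Q : mem -> Prop) (m : mem) : Prop :=
  match c with
  | Skip => Q m
  | Instr c => [/\ target c m < N, result c m <= V &
                  Q (put m (target c m) (result c m))]
  | Seq c1 c2 => wp c1 (wp c2 Q) m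
  | If i c1 c2 => if get m i != 0 then wp c1 Q m else wp c2 Q m
  | While _ _ => False
  end.

(** Both branches are counted, so that the time bound does not depend on the memory. *)
Fixpoint steps (c : prog) : nat :=
  match c with
  | Skip | While _ _ => 0
  | Instr _ => 1
  | Seq c1 c2 => steps c1 + steps c2
  | If _ c1 c2 => (steps c1 + steps c2).+1
  end.

Definition halts (c : prog) (m : mem) (T : nat) (Q : mem -> Prop) : Prop :=
  exists t m', [/\ exec space c m t m', t <= T, bounded m' & Q m'].

Lemma wp_sound c Q m : bounded m -> wp c Q m ->
  halts c m (steps c * instr_time) Q.
Proof.
elim: c Q m => [|c|c1 IH1 c2 IH2|i c1 IH1 c2 IH2|i c _] Q m bm //=.
- by move=> Qm; exists 0, m; split=> //; constructor; exact: bits_bounded.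
- move=> [Ht Hr HQ]; have bm' := bounded_put bm Ht Hr.
  exists (cost c m), (effect c m); rewrite effectE mul1n; split=> //.
    by rewrite -effectE; constructor; rewrite ?effectE; exact: bits_bounded.
  exact: cost_bounded.
- move=> /(IH1 _ _ bm)[t1 [m1 [E1 T1 b1 /(IH2 _ _ b1)[t2 [m2 [E2 T2 b2 Q2]]]]]].
  exists (t1 + t2), m2; split=> //; first exact: ExSeq E1 E2.
  by rewrite mulnDl leq_add.
- have Hi : bitlen (get m i) <= instr_time.
    by apply: leq_trans (bitlen_time (bm.2 i)) _; rewrite /instr_time leq_pmull.
  rewrite mulSn mulnDl; case: ifP => [gi|/negbFE gi].
    move=> /(IH1 _ _ bm)[t1 [m1 [E1 T1 b1 Q1]]].
    exists (bitlen (get m i) + t1), m1; split=> //; first exact: ExIfT.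
    by rewrite leq_add // (leq_trans T1) // leq_addr.
  move=> /(IH2 _ _ bm)[t1 [m1 [E1 T1 b1 Q1]]].
  exists (bitlen (get m i) + t1), m1; split=> //; first exact: ExIfF.
  by rewrite leq_add // (leq_trans T1) // leq_addl.
Qed.

End Machine.

(** * The algorithm *)

Definition straight (cs : seq instr) (c : prog) : prog :=
  foldr (fun i c' => Seq (Instr i) c') c cs.

(* Cells 2 and 3 hold p and alpha, cell 4 the address of record B, cells 5 and
   6 those of the top records of the explicit stack and of the stack of items,
   cell 7 is nonzero after a rejection, cell 8 holds B, and 9 to 15 are scratch.
   Record j consists of cells 16 + 4j to 19 + 4j: the hash of the j bottom
   letters of the explicit stack, then, for the j-th item from the bottom, the
   difference of the hashes of o and c, the number of letters left, and
   alpha ^ size c.  Popping an explicit letter needs no stored letters, since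
   two words differing only in their top letter have different hashes. *)
Definition open_prog : prog :=
  straight [:: Fetch 9 5; Bin Mul 9 9 3; Bin Add 9 9 10; Bin Mod 9 9 2;
               Lit 11 4; Bin Add 5 5 11; Store 5 9; Bin Sub 12 4 5]
  (If 12 Skip
    (straight [:: Bin Add 6 6 11; Lit 12 1; Bin Add 13 6 12; Store 13 9;
                  Bin Add 13 13 12; Store 13 8; Bin Add 13 13 12; Store 13 12;
                  Lit 5 16] Skip)).

(** The hash that the expected letter would have produced is recomputed from the record below. One
    of the two truncated differences is 0, so their sum, put in cell 7, vanishes exactly when the
    hashes agree. *)
Definition pop_prog : prog :=
  straight [:: Fetch 9 5; Lit 11 4; Bin Sub 5 5 11; Fetch 12 5;
               Bin Mul 12 12 3; Bin Add 12 12 10; Bin Mod 12 12 2;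
               Bin Sub 11 9 12; Bin Sub 12 12 9; Bin Add 7 11 12] Skip.

(** Cells 12 to 14 hold the addresses of the three fields of the item. Once no letter is left, the
    difference of the hashes itself is added to the rejection flag. *)
Definition consume_prog : prog :=
  straight [:: Lit 11 1; Bin Add 12 6 11; Bin Add 13 12 11; Bin Add 14 13 11;
               Fetch 9 14; Bin Sub 10 2 10; Bin Mul 10 10 9; Fetch 15 12;
               Bin Add 10 10 15; Bin Mod 10 10 2; Store 12 10;
               Bin Mul 9 9 3; Bin Mod 9 9 2; Store 14 9;
               Fetch 9 13; Bin Sub 9 9 11; Store 13 9]
  (If 9 Skip
    (straight [:: Lit 9 4; Bin Sub 6 6 9; Bin Add 7 7 10] Skip)).

(** A stack is empty when its top address is 16, that of record 0. *)
Definition letter_prog : prog :=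
  If 7 Skip
  (straight [:: Lit 9 2; Bin Div 10 0 9; Bin Mod 11 0 9]
    (If 11
      (straight [:: Lit 11 16; Bin Sub 12 5 11]
        (If 12 pop_prog
          (straight [:: Bin Sub 12 6 11]
            (If 12 consume_prog (Instr (Lit 7 1))))))
      open_prog)).

Definition post_prog : prog :=
  If 7 (Instr (Lit 0 0))
  (straight [:: Lit 9 16; Bin Sub 10 5 9; Bin Sub 11 6 9; Bin Add 10 10 11]
    (If 10 (Instr (Lit 0 0)) (Instr (Lit 0 1)))).

(** Doubling [B] until [B * B] reaches [n] avoids a square root; the truncated subtraction in cell 9
    stops the loop. *)
Definition pre_loop : prog :=
  While 9 (straight [:: Bin Add 8 8 8; Bin Mul 9 8 8; Bin Sub 9 1 9] Skip).

Definition pre_prog : prog :=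
  Seq (straight [:: Lit 8 1; Lit 9 1; Bin Sub 9 1 9] Skip)
  (Seq pre_loop
    (straight [:: Lit 9 4; Bin Mul 4 9 8; Lit 5 16; Bin Add 4 4 5; Lit 6 16]
      Skip)).

(** * Symbolic execution of straight-line code *)

Arguments wp : simpl never.

Lemma get_put_eq m d v : get (put m d v) d = v.
Proof. by rewrite get_put eqxx. Qed.

(** Through [a] and [v] the written cell and value are recorded in simplified form, which keeps
    terms from growing with each instruction. *)
Lemma wp_straight N V i cs c Q m a v :
  target i m = a -> result i m = v -> a < N -> v <= V ->
  wp N V (straight cs c) Q (put m a v) -> wp N V (straight (i :: cs) c) Q m.
Proof. by move=> <- <-. Qed.

Lemma wp_if N V i c1 c2 (Q : mem -> Prop) m v : get m i = v ->
  (v != 0 -> wp N V c1 Q m) -> (v = 0 -> wp N V c2 Q m) ->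
  wp N V (If i c1 c2) Q m.
Proof.
by rewrite /wp => -> H1 H2; case: eqP => [/H2|/eqP/H1].
Qed.

Ltac read := repeat match goal with
  | |- context [get (put ?m ?d ?v) ?d] => rewrite (get_put_eq m d v)
  | |- context [get (put ?m ?d ?v) ?i] =>
    lazymatch i with context [put] => fail | _ => idtac end;
    rewrite (@get_put_neq m d v i); last by first [done | lia]
  end.

Ltac exec val := eapply (@wp_straight _ _ _ _ _ _ _ _ val);
  [cbn [target]; read; eassumption || reflexivity
  |cbn [result binop_fun]; read|try lia|try lia|].

Ltac branch val := apply: (@wp_if _ _ _ _ _ _ _ val); [read| |].

(** * The memory layout as an invariant *)

Section Represents.
Variables p al B : nat.

(** Every suffix, the empty one included, keeps its hash, so popping only lowers the address in cell
    5. *)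
Fixpoint letters_at (m : mem) (es : seq bool) : Prop :=
  get m (16 + 4 * size es) = hash p al es /\
  if es is _ :: es' then letters_at m es' else True.

Fixpoint items_at (m : mem) (its : seq (seq bool * seq bool)) : Prop :=
  if its is (o, c) :: its' then
    [/\ get m (16 + 4 * size its + 1) = hash_diff p al o c,
        get m (16 + 4 * size its + 2) = B - size c,
        get m (16 + 4 * size its + 3) = al ^ size c %% p &
        items_at m its']
  else True.

(** Letters use offset 0 of the records and items offsets 1 to 3, so the two stacks do not
    interfere. After a rejection the stacks are left unspecified. *)
Definition represents (m : mem) (st : option sketch) : Prop :=
  [/\ get m 2 = p, get m 3 = al, get m 4 = 16 + 4 * B, get m 8 = B &
      if st is Some (es, its) then
        [/\ get m 5 = 16 + 4 * size es, get m 6 = 16 + 4 * size its,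
            get m 7 = 0, letters_at m es & items_at m its]
      else get m 7 != 0].

Lemma letters_at_cons m x es :
  get m (16 + 4 * (size es).+1) = hash p al (x :: es) -> letters_at m es ->
  letters_at m (x :: es).
Proof. by []. Qed.

Lemma items_at_cons m o c its :
  get m (16 + 4 * (size its).+1 + 1) = hash_diff p al o c ->
  get m (16 + 4 * (size its).+1 + 2) = B - size c ->
  get m (16 + 4 * (size its).+1 + 3) = al ^ size c %% p ->
  items_at m its -> items_at m ((o, c) :: its).
Proof. by []. Qed.

(** This lets the explicit part restart at record 0 after a compression without rewriting cell
    16. *)
Lemma letters_at_bottom m es : letters_at m es -> get m 16 = 0.
Proof. by elim: es => [|x es IH] [] // _ /IH. Qed.

Lemma letters_at_frame m m' es :
  (forall j, j <= size es -> get m' (16 + 4 * j) = get m (16 + 4 * j)) ->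
  letters_at m es -> letters_at m' es.
Proof.
elim: es => [|x es IH] /= H [H0 H1]; split=> //; rewrite ?H //.
by apply: IH H1 => j js; apply: H; lia.
Qed.

Lemma items_at_frame m m' its :
  (forall j k, j <= size its -> 0 < k < 4 ->
    get m' (16 + 4 * j + k) = get m (16 + 4 * j + k)) ->
  items_at m its -> items_at m' its.
Proof.
elim: its => [|[ o c] its IH] //= H [H1 H2 H3 H4]; rewrite !H //; split=> //.
by apply: IH H4 => j k js; apply: H; lia.
Qed.

Lemma represents_scratch m m' st :
  (forall i, 1 < i <= 8 \/ 16 <= i -> get m' i = get m i) ->
  represents m st -> represents m' st.
Proof.
move=> H; case: st => [[es its]|]; last by rewrite /represents !H //; lia.
case=> H2 H3 H4 H8 [H5 H6 H7 He Hi].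
split; rewrite ?H //; try lia; split; rewrite ?H //; try lia.
  by apply: letters_at_frame He => j js; rewrite H //; lia.
by apply: items_at_frame Hi => j k js ks; rewrite H //; lia.
Qed.

End Represents.

(** An item counts for [B] letters even when partly popped. A letter thus adds at most 1, and the
    load bounds the number of items. *)
Definition load (B : nat) (st : sketch) : nat := size st.2 * B + size st.1.

Lemma step_load test B st l st' :
  step test B st l = Some st' -> load B st' <= (load B st).+1.
Proof.
case: st => es its; rewrite /step /load /=; case: (closing l).
  case: es => [|y es].
    case: its => [|[ o c] its] //; case: ifP => [_ [ <-]|_] //=.
    by case: ifP => // _ [ <-] /=; lia.
  by case: ifP => // _ [ <-] /=; lia.
by case: ifP => [_ [ <-]|Hs [ <-]] /=; lia.
Qed.

(** * Correctness of the letter and final programs *)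

Section Step.
Variables N V p al B : nat.
Hypotheses (p2 : 1 < p) (alp : al < p) (B0 : 0 < B).
(** Record [B] ends at cell [19 + 4 * B], and addresses are themselves stored in cells. [p * p + p]
    leaves room for a product plus a residue before reduction. *)
Hypotheses (BN : 20 + 4 * B <= N) (BV : 20 + 4 * B <= V) (pV : p * p + p <= V).

Lemma horner_bound a (x : bool) : a < p -> a * al + x <= p * p.
Proof. by move=> ap; case: x => /=; nia. Qed.

Lemma letters_at_top m es : letters_at p al m es ->
  get m (16 + 4 * size es) = hash p al es.
Proof. by case: es => [|? ?] []. Qed.

Lemma open_wp test m es its l :
  ~~ closing l -> get m 10 = kind l -> size es < B -> size its < B ->
  represents p al B m (Some (es, its)) ->
  wp N V open_prog
    (fun m' => represents p al B m' (step test B (es, its) l)) m.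
Proof.
move=> /negbTE cl Hk Hes Hits [H2 H3 H4 H8 [H5 H6 H7 He Hi]].
have Hh := letters_at_top He.
have hlt := hash_lt al p2 es; have hb := horner_bound (kind l) hlt.
have hlt' := hash_lt al p2 (kind l :: es); have pV' : p <= V by lia.
rewrite /open_prog.
exec (hash p al es); first by rewrite H5.
exec (hash p al es * al); first by rewrite H3.
exec (hash p al es * al + kind l); first by rewrite Hk.
exec (hash p al (kind l :: es)); first by rewrite H2.
exec 4; first by [].
exec (16 + 4 * (size es).+1); first by rewrite H5 /=; lia.
exec (hash p al (kind l :: es)); first by [].
exec (4 * (B - (size es).+1)); first by rewrite H4; lia.
branch (4 * (B - (size es).+1)) => [//|Hs|Hs].
  rewrite /wp /step cl ifT; last by rewrite /=; lia.
  split; read => //; split; read => //.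
    apply: letters_at_cons; first by read.
    by apply: letters_at_frame He => j js; read.
  apply: items_at_frame Hi => j k js ks; read => //.
(* The distance to the address of record [B] is 0 exactly when the [B]-th letter has been pushed. *)
have Es : (size es).+1 = B by lia.
exec (16 + 4 * (size its).+1); first by rewrite H6; lia.
exec 1; first by [].
exec (16 + 4 * (size its).+1 + 1); first by [].
exec (hash p al (kind l :: es)); first by [].
exec (16 + 4 * (size its).+1 + 2); first lia.
exec B; first by rewrite H8.
exec (16 + 4 * (size its).+1 + 3); first lia.
exec 1; first by [].
exec 16; first by [].
rewrite /wp /step cl ifF; last by rewrite /=; lia.
split; read => //; split; read => //.
  by split=> //; read; apply: letters_at_bottom He.
apply: items_at_cons; read => //.
- by rewrite hash_diff_nil.
- by rewrite subn0.
- by rewrite expn0 modn_small.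
by apply: items_at_frame Hi => j k js ks; read => //.
Qed.

Lemma pop_wp test m x es its l :
  closing l -> get m 10 = kind l -> size (x :: es) < B ->
  represents p al B m (Some (x :: es, its)) ->
  wp N V pop_prog
    (fun m' => represents p al B m' (step test B (x :: es, its) l)) m.
Proof.
move=> cl Hk Hes [H2 H3 H4 H8 [H5 H6 H7 [Hx He] Hi]].
rewrite /= in Hes H5 Hx.
have Hh := letters_at_top He.
have hlt := hash_lt al p2 es; have hb := horner_bound (kind l) hlt.
have hlt' y := hash_lt al p2 (y :: es); have pV' : p <= V by lia.
have h1 := hlt' x; have h2 := hlt' (kind l).
rewrite /pop_prog.
exec (hash p al (x :: es)); first by rewrite H5.
exec 4; first by [].
exec (16 + 4 * size es); first by rewrite H5; lia.
exec (hash p al es); first by [].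
exec (hash p al es * al); first by rewrite H3.
exec (hash p al es * al + kind l); first by rewrite Hk.
exec (hash p al (kind l :: es)); first by rewrite H2.
exec (hash p al (x :: es) - hash p al (kind l :: es)); first by [].
exec (hash p al (kind l :: es) - hash p al (x :: es)); first by [].
set f := hash p al (x :: es) - hash p al (kind l :: es) +
  (hash p al (kind l :: es) - hash p al (x :: es)).
exec f; first by [].
have Ef : (f == 0) = (x == kind l).
  by rewrite -(hash_eq_cons al p2 x (kind l) es) /f; apply/idP/idP; lia.
rewrite /wp /step cl -Ef; case: eqP => [f0|/eqP f0]; split; read => //.
split; read => //.
  by apply: letters_at_frame He => j js; read.
by apply: items_at_frame Hi => j k js ks; read => //.
Qed.

Lemma consume_wp m o c its l :
  closing l -> get m 10 = kind l -> get m 11 = 16 -> size c < B ->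
  size its < B ->
  represents p al B m (Some ([::], (o, c) :: its)) ->
  wp N V consume_prog
    (fun m' => represents p al B m'
       (step (hash_test p al) B ([::], (o, c) :: its) l)) m.
Proof.
move=> cl Hk H11 Hc Hits [H2 H3 H4 H8 [H5 H6 H7 He [Hd Hm Hq Hi]]].
rewrite /= in H5 H6 Hd Hm Hq.
have {}Hi : items_at p al B m its := Hi.
have qp : al ^ size c %% p < p by rewrite ltn_pmod; lia.
have dp : hash_diff p al o c < p by rewrite ltn_pmod; lia.
have Ed := hash_diff_rcons al p2 o c (kind l).
have Eq : (al ^ size c %% p) * al %% p = al ^ (size c).+1 %% p.
  by rewrite modnMml -expnSr.
have dp' : hash_diff p al o (rcons c (kind l)) < p by rewrite ltn_pmod; lia.
have qp' : al ^ (size c).+1 %% p < p by rewrite ltn_pmod; lia.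
have Es : step (hash_test p al) B ([::], (o, c) :: its) l =
    if (size c).+1 < B then Some ([::], (o, rcons c (kind l)) :: its)
    else if hash_diff p al o (rcons c (kind l)) == 0 then Some ([::], its)
    else None.
  by rewrite /step cl size_rcons hash_diff_eq0.
(* The address, the differences and the powers become variables, so that the arithmetic goals do not
   see their definitions. *)
have [a Ha] : {a | a = 16 + 4 * (size its).+1} by eexists.
rewrite -Ha in H6 Hd Hm Hq.
move: (al ^ size c %% p) (hash_diff p al o c) qp dp Ed Eq Hd Hq
  => q d qp dp Ed Eq Hd Hq.
have Hi' m' : get m' (a + 1) = hash_diff p al o (rcons c (kind l)) ->
    get m' (a + 2) = B - (size c).+1 ->
    get m' (a + 3) = al ^ (size c).+1 %% p -> items_at p al B m' its ->
    items_at p al B m' ((o, rcons c (kind l)) :: its).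
  by rewrite Ha => *; apply: items_at_cons; rewrite ?size_rcons.
move: (hash_diff p al o (rcons c (kind l))) (al ^ (size c).+1 %% p)
  dp' qp' Ed Eq Es Hi' => d' q' dp' qp' Ed Eq Es Hi'.
have b1 : (p - kind l) * q <= p * p by apply: leq_mul; lia.
have b2 : q * al <= p * p by apply: leq_mul; lia.
have b3 : (p - kind l) * q + d <= V by lia.
have b4 : q * al <= V by lia.
have [dV qV dV' qV' pV'] : [/\ d <= V, q <= V, d' <= V, q' <= V & p <= V].
  by split; lia.
clear b1 b2 qp dp qp' dp'.
rewrite /consume_prog.
exec 1; first by [].
exec (a + 1); first by rewrite H6.
exec (a + 2); first by rewrite -addnA.
exec (a + 3); first by rewrite -addnA.
exec q; first by [].
exec (p - kind l); first by rewrite H2 Hk.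
exec ((p - kind l) * q); first by [].
exec d; first by [].
exec ((p - kind l) * q + d); first by [].
exec d'; first by rewrite H2.
exec d'; first by [].
exec (q * al); first by rewrite H3.
exec q'; first by rewrite H2.
exec q'; first by [].
exec (B - size c); first by [].
exec (B - (size c).+1); first by lia.
exec (B - (size c).+1); first by [].
branch (B - (size c).+1) => [//|Hs|Hs].
  rewrite /wp Es ifT; last by lia.
  split; read => //; split; read => //.
  - by rewrite H6 Ha.
  - by split=> //; read; apply: letters_at_bottom He.
  - apply: Hi'; read => //.
    by apply: items_at_frame Hi => j k js ks; read => //.
(* The block is complete: the item is dropped, and cell 7, which was 0, receives [d']. *)
exec 4; first by [].
exec (16 + 4 * size its); first by rewrite H6; lia.
exec d'; first by rewrite H7.
rewrite /wp Es ifF; last by lia.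
case: eqP => [d0|/eqP d0]; split; read => //.
split; read => //.
  by split=> //; read; apply: letters_at_bottom He.
by apply: items_at_frame Hi => j k js ks; read => //.
Qed.

(** [k] is the number of letters still to come; each one may raise the load by 1. *)
Definition room (st : option sketch) (k : nat) : bool :=
  if st is Some s then well_sized B s && (load B s + k <= B * B) else true.

Lemma letter_wp m st l : room st 1 ->
  represents p al B m st ->
  wp N V letter_prog
    (fun m' => represents p al B m'
       (obind (fun s => step (hash_test p al) B s l) st))
    (put m 0 (code l)).
Proof.
move=> ws Hst; have pV' : p <= V by lia.
have cl4 : code l <= 3 by case: (l).
case: st ws Hst => [[es its]|_ Hst]; last first.
  have [_ _ _ _ H7] := Hst.
  apply: (@wp_if _ _ _ _ _ _ _ (get m 7)); first by read.
    by move=> _; apply: represents_scratch Hst => i ilt; read.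
  by move=> E; rewrite E in H7.
move=> /andP[/andP[/= Hes Hall] Hload] Hst.
(* The pending letter makes this strict, so record [(size its).+1] is available for a new item. *)
have Hits : size its < B by move: Hload; rewrite /load /=; nia.
have [H2 H3 H4 H8 [H5 H6 H7 He Hi]] := Hst.
rewrite -[X in wp _ _ _ X _]/(fun m' => represents p al B m'
  (step (hash_test p al) B (es, its) l)).
rewrite /letter_prog; branch 0 => [//|//|_].
exec 2; first by [].
exec (nat_of_bool (kind l)); first by rewrite code_kind.
exec (nat_of_bool (closing l)); first by rewrite code_closing.
branch (nat_of_bool (closing l)) => [//|cl|ncl]; last first.
  apply: (@open_wp (hash_test p al)) => //.
  - by case: closing ncl.
  - by read.
  - by apply: represents_scratch Hst => i ilt; read.
have {}cl : closing l by case: closing cl.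
exec 16; first by [].
exec (4 * size es); first by rewrite H5; lia.
branch (4 * size es) => [//|es0|es0].
  case: es es0 Hes Hst {Hload H5 He} => [//|x es] _ Hes Hst.
  apply: (@pop_wp (hash_test p al)) => //.
  - by read.
  - by apply: represents_scratch Hst => i ilt; read.
have {}es0 : es = [::] by case: es es0 {Hes Hst Hload H5 He}.
subst es.
exec (4 * size its); first by rewrite H6; lia.
branch (4 * size its) => [//|its0|its0].
  case: its its0 Hits Hst Hall {Hload H6 Hi} => [//|[ o c] its] _ Hits Hst.
  move=> /andP[/andP[_ Hc] _].
  apply: consume_wp => //; try by read.
  - by move: Hits => /=; lia.
  - by apply: represents_scratch Hst => i ilt; read.
have -> : its = [::] by case: its its0 {Hits Hst Hload H6 Hi Hall}.
rewrite /step cl /wp; split; rewrite /=; [lia|lia|].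
by split; read.
Qed.

(** [8 * B] bounds the sum [4 * size es + 4 * size its] written to cell 10. *)
Lemma post_wp m st : 8 * B <= V -> represents p al B m st ->
  room st 0 -> wp N V post_prog (fun m' => (get m' 0 != 0) = accepted st) m.
Proof.
move=> BV8; case: st => [[es its]|] [H2 H3 H4 H8]; last first.
  move=> H7 _; apply: (@wp_if _ _ _ _ _ _ _ (get m 7)) => //.
    by move=> _; split; rewrite /=; [lia|lia|read].
  by move=> E; rewrite E in H7.
move=> [H5 H6 H7 He Hi] /= /andP[/andP[/= Hes _] Hload].
have Hits : size its <= B by move: Hload; rewrite /load /=; nia.
apply: (@wp_if _ _ _ _ _ _ _ 0) => // _.
exec 16; first by [].
exec (4 * size es); first by rewrite H5; lia.
exec (4 * size its); first by rewrite H6; lia.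
exec (4 * size es + 4 * size its); first by [].
branch (4 * size es + 4 * size its) => [//|nz|z].
  split; rewrite /=; [lia|lia|read].
  by rewrite /accepted; case: es its nz {Hes Hits Hload H5 H6 He Hi} => [|? ?] [|? ?].
split; rewrite /=; [lia|lia|read].
by rewrite /accepted; case: es its z {Hes Hits Hload H5 H6 He Hi} => [|? ?] [|? ?].
Qed.

Lemma stream_halts A T st m w :
  process_letter A = letter_prog -> steps letter_prog * instr_time V <= T ->
  bounded N V m -> represents p al B m st -> room st (size w) ->
  exists m', [/\ read_stream A (space N V) T m w m', bounded N V m',
    represents p al B m' (run (hash_test p al) B st w) &
    room (run (hash_test p al) B st w) 0].
Proof.
move=> EA HT; elim: w st m => [|l w IH] st m bm Hm Hst.
  by exists m; split=> //; constructor.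
have bm0 : bounded N V (put m 0 (code l)).
  by apply: bounded_put => //; [lia|case: (l); rewrite /=; lia].
have ws : room st 1.
  by case: st Hst {Hm} => [s|] //= /andP[-> ?]; rewrite /=; lia.
have [t [m1 [E1 T1 b1 R1]]] := wp_sound bm0 (letter_wp l ws Hm).
have [|m2 [E2 b2 R2 S2]] := IH _ _ b1 R1; last first.
  exists m2; split=> //; apply: ReadCons E2; first by rewrite EA; exact: E1.
  exact: leq_trans HT.
case: st Hst {Hm ws R1} => [s|] //= /andP[Hs Hl].
case E: (step _ _ _ _) => [s'|] //=.
rewrite (step_well_sized B0 Hs E) /=.
by have := step_load E; lia.
Qed.

End Step.

(** * Preprocessing: computation of the block size *)

Lemma halts_seq N V c1 c2 m T1 T2 (Q1 Q : mem -> Prop) :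
  halts N V c1 m T1 Q1 ->
  (forall m1, bounded N V m1 -> Q1 m1 -> halts N V c2 m1 T2 Q) ->
  halts N V (Seq c1 c2) m (T1 + T2) Q.
Proof.
move=> [t1 [m1 [E1 H1 b1 q1]]] /(_ m1 b1 q1) [t2 [m2 [E2 H2 b2 q2]]].
by exists (t1 + t2), m2; split; [exact: ExSeq E1 E2|rewrite leq_add| |].
Qed.

Section Preprocess.
Variables N V n p al : nat.
Let e := up_log 4 n.
Let B := 2 ^ e.
Hypotheses (nV : 4 * n <= V) (n0 : 0 < n).
Hypotheses (BN : 20 + 4 * B <= N) (BV : 20 + 4 * B <= V).

Let inputs (m : mem) :=
  [/\ get m 1 = n, get m 2 = p, get m 3 = al, get m 7 = 0 & get m 16 = 0].

(** Induction on the number [e - i] of remaining turns. A turn costs one test and three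
    instructions, and a last test ends the loop. *)
Lemma pre_loop_halts i m :
  i <= e -> bounded N V m -> inputs m -> get m 8 = 2 ^ i ->
  get m 9 = n - 4 ^ i ->
  halts N V pre_loop m ((e - i).+1 * (4 * instr_time V))
    (fun m' => inputs m' /\ get m' 8 = B).
Proof.
have [d] := ubnP (e - i); elim: d i m => // d IH i m di ie bm Hin H8 H9.
have bt : bitlen (get m 9) <= instr_time V.
  by apply: leq_trans (bitlen_time (bm.2 9)) _; rewrite /instr_time leq_pmull.
have ne : n <= 4 ^ e by rewrite up_logP.
have [H9n|H9n] := boolP (get m 9 == 0).
  have ei : e = i.
    by apply/eqP; rewrite eqn_leq ie andbT; apply: up_log_min => //; lia.
  exists (bitlen (get m 9)), m; split=> //; last by rewrite /B ei.
    by apply: ExWhileF => //; exact: bits_bounded.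
  by apply: (leq_trans bt); rewrite mulnA leq_pmull.
have lin : 4 ^ i < n by lia.
have lie : i < e.
  by rewrite ltnNge; apply/negP => ei; have := leq_pexp2l (isT : 0 < 4) ei; lia.
have E2 : 2 ^ i.+1 * 2 ^ i.+1 = 4 ^ i.+1 by rewrite -expnMn.
(* The last square computed may exceed [n], but stays below [4 * n]. *)
have l4 : 4 ^ i.+1 <= V by rewrite expnS; lia.
have l2 : 2 ^ i.+1 <= V by have := expn_gt0 2 i.+1; nia.
have [H1 H2 H3 H7 H16] := Hin.
have [|t1 [m1 [E1 T1 b1 [Hin1 [H81 H91]]]]] := @wp_sound N V
    (straight [:: Bin Add 8 8 8; Bin Mul 9 8 8; Bin Sub 9 1 9] Skip)
    (fun m' => inputs m' /\ get m' 8 = 2 ^ i.+1 /\ get m' 9 = n - 4 ^ i.+1) m bm.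
  exec (2 ^ i.+1); first by rewrite H8 expnS; lia.
  exec (4 ^ i.+1); first by [].
  exec (n - 4 ^ i.+1); first by rewrite H1.
  by rewrite /wp; split; [split; read|split; read].
have [|t2 [m2 [E2' T2 b2 Q2]]] := IH i.+1 m1 _ lie b1 Hin1 H81 H91; first lia.
exists (bitlen (get m 9) + t1 + t2), m2; split=> //.
  exact: ExWhileT E1 E2'.
rewrite mulSn leq_add //; last first.
  by apply: leq_trans T2 _; rewrite leq_mul2r; apply/orP; right; lia.
by apply: leq_trans (leq_add bt T1) _; rewrite /=; lia.
Qed.

Lemma pre_halts : bounded N V [:: 0; n; p; al] ->
  halts N V pre_prog [:: 0; n; p; al] ((4 * e + 12) * instr_time V)
    (fun m => represents p al B m (Some ([::], [::]))).
Proof.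
move=> bm.
(* Three instructions precede the loop and five follow it. *)
rewrite (_ : (4 * e + 12) * _ = 3 * instr_time V +
    ((e - 0).+1 * (4 * instr_time V) + 5 * instr_time V)); last first.
  by rewrite subn0 mulnA -!mulnDl; congr (_ * _); lia.
apply: (@halts_seq _ _ _ _ _ _ _ (fun m => inputs m /\
    get m 8 = 2 ^ 0 /\ get m 9 = n - 4 ^ 0)).
  apply: (wp_sound bm).
  exec 1; first by [].
  exec 1; first by [].
  exec (n - 1); first by [].
  by rewrite /wp; split; [split; read|split; read].
move=> m1 b1 [Hin [H8 H9]].
apply: (halts_seq (pre_loop_halts (leq0n e) b1 Hin H8 H9)).
move=> m2 b2 [[H1 H2 H3 H7 H16] {}H8].
apply: (wp_sound b2).
exec 4; first by [].
exec (4 * B); first by rewrite H8.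
exec 16; first by [].
exec (16 + 4 * B); first by lia.
exec 16; first by [].
by rewrite /wp; split; read => //; split; read => //; split; read.
Qed.

End Preprocess.

Definition dyck2_algorithm : algorithm :=
  Algorithm pre_prog letter_prog post_prog.

Definition block_size (n : nat) : nat := 2 ^ up_log 4 n.

Lemma block_sizeP n : n <= block_size n * block_size n.
Proof. by rewrite /block_size -expnMn; exact: up_logP. Qed.

(** The constant 100 exceeds the instruction counts of the letter and final programs; the
    logarithmic term pays for the preprocessing loop. *)
Lemma dyck2_algorithm_outcome N V T n p al x :
  let B := block_size n in
  0 < n -> 1 < p -> al < p -> size x = n ->
  20 + 4 * B <= N -> 20 + 8 * B <= V -> 4 * n <= V -> p * p + p <= V ->
  (4 * up_log 4 n + 100) * instr_time V <= T ->
  outcome dyck2_algorithm 1 (space N V) T n p al x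
    (accepted (run (hash_test p al) B (Some ([::], [::])) x)).
Proof.
move=> B n0 p2 alp sx BN BV nV pV HT.
have B0 : 0 < B by rewrite expn_gt0.
have BV4 : 20 + 4 * B <= V by lia.
have bm : bounded N V [:: 0; n; p; al].
  split; first by rewrite /=; lia.
  by move=> [|[|[|[|i]]]]; rewrite /get /= ?nth_nil; lia.
have HT' k : k <= 4 * up_log 4 n + 100 -> k * instr_time V <= T.
  by move=> kle; apply: leq_trans HT; rewrite leq_mul2r kle orbT.
have [t0 [m0 [E0 T0 b0 R0]]] := pre_halts nV n0 BN BV4 bm.
have sT : steps letter_prog * instr_time V <= T by apply: HT'; rewrite /=; lia.
have [|m1 [E1 b1 R1 S1]] :=
    stream_halts (w := x) p2 alp B0 BN BV4 pV (erefl : process_letter dyck2_algorithm = _) sT b0 R0.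
  by rewrite /room /well_sized /load /= B0 sx; exact: block_sizeP.
have [|t2 [m2 [E2 T2 b2 R2]]] := wp_sound b1 (post_wp p2 alp B0 BN BV4 pV _ R1 S1).
  by lia.
exists t0, m0, m1, t2, m2; split=> //=.
- by split=> //; apply: leq_trans T0 _; apply: HT'; lia.
- by rewrite cats0.
- by split=> //; apply: leq_trans T2 _; apply: HT'; rewrite /=; lia.
Qed.

(** * Error probability and asymptotics *)

Section Collisions.
Variable p : nat.
Hypothesis pp : prime p.
Local Open Scope ring_scope.

Definition bool_poly (s : seq bool) : {poly 'F_p} :=
  Poly [seq (nat_of_bool x)%:R | x <- s].

Lemma hash_horner al s : (hash p al s)%:R = (bool_poly s).[al%:R] :> 'F_p.
Proof.
elim: s => [|x s IH] /=; first by rewrite /bool_poly /= horner0.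
rewrite /bool_poly /= cons_poly_def Fp_nat_mod // natrD natrM IH.
by rewrite !hornerE.
Qed.

(** [Poly] forgets trailing zeros, which equal lengths recover; 0 and 1 are distinct in ['F_p]. *)
Lemma bool_poly_inj o c : size o = size c -> bool_poly o = bool_poly c -> o = c.
Proof.
move=> soc E; apply: (@eq_from_nth _ false) => // i io.
have : (bool_poly o)`_i = (bool_poly c)`_i by rewrite E.
rewrite !coef_Poly !(nth_map false) -?soc // => /(congr1 val) /=.
rewrite !val_Fp_nat // !modn_small; last 2 first.
- by case: nth; rewrite ?prime_gt1 ?prime_gt0.
- by case: nth; rewrite ?prime_gt1 ?prime_gt0.
by case: nth; case: nth.
Qed.

(** Colliding values are roots of a nonzero polynomial of degree less than [size o]. *)
Lemma card_collisions o c : o != c -> size o = size c ->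
  (#|[set al : 'I_p | hash_test p al o c]%SET| < size o)%N.
Proof.
move=> oc soc; set S := [set _ | _]%SET.
pose P := bool_poly o - bool_poly c.
have P0 : P != 0.
  by rewrite subr_eq0; apply: contra_neq oc => /bool_poly_inj ->.
have sP : (size P <= size o)%N.
  apply: leq_trans (size_polyD _ _) _; rewrite size_polyN geq_max.
  by rewrite {2}soc !(leq_trans (size_Poly _)) ?size_map.
apply: leq_trans sP.
rewrite cardE -(size_map (fun al : 'I_p => (al%:R : 'F_p))).
apply: max_poly_roots => //.
  apply/allP => _ /mapP[al + ->]; rewrite mem_enum inE => /eqP E.
  by rewrite /root hornerD hornerN -!hash_horner E subrr.
(* Distinct naturals below [p] give distinct roots in ['F_p]. *)
rewrite map_inj_uniq ?enum_uniq // => i j /(congr1 val) /=.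
by rewrite !val_Fp_nat // !modn_small // => /val_inj.
Qed.

End Collisions.

(** * Estimates of block size, cell size, space and time *)

Lemma leq_block_size n : 0 < n -> block_size n <= n.
Proof.
rewrite /block_size; case: n => [|[|n]] // _.
have /andP[+ _] := @up_log_bounds 4 n.+2 isT isT.
case: (up_log 4 n.+2) => [|e] //= He.
(* By minimality, half the block size [q] satisfies [q * q < n], and [2 * q <= q * q + 1]. *)
have : 2 ^ e * 2 ^ e < n.+2 by rewrite -expnMn.
by rewrite expnS; nia.
Qed.

Lemma block_size_sq n : 0 < n -> block_size n ^ 2 <= 4 * n.
Proof.
have -> : block_size n ^ 2 = 4 ^ up_log 4 n.
  by rewrite /block_size -expnM mulnC expnM.
case: n => [|[|n]] // _; have /andP[+ _] := @up_log_bounds 4 n.+2 isT isT.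
by case: (up_log 4 n.+2) => [|e] //= He; rewrite expnS; lia.
Qed.

Lemma up_log_bitlen n : 0 < n -> up_log 4 n <= bitlen n.
Proof.
case: n => [|[|n]] // _; have /andP[+ _] := @up_log_bounds 4 n.+2 isT isT.
case: (up_log 4 n.+2) => [|e] //= He.
rewrite ltnS; apply: trunc_log_max => //; apply: leq_trans (ltnW He).
by rewrite (_ : 4 = 2 * 2) // expnMn leq_pmulr // expn_gt0.
Qed.

Section Bounds.
(* e is chosen so that 2 n ^ e bounds the prime p. *)
Variable e : nat.

(** The factor 64 is ample: [p * p + p] is at most [8 * n ^ (2 * e)], and [20 + 8 * block_size n] at
    most [28 * n]. *)
Definition cell_bound (n : nat) : nat := 64 * n ^ (2 * e).
Definition space_bound (n : nat) : nat :=
  space (20 + 4 * block_size n) (cell_bound n).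
Definition time_bound (n : nat) : nat :=
  (4 * up_log 4 n + 100) * instr_time (cell_bound n).

Lemma bounded_outcome n p al x : 0 < e -> 0 < n -> 1 < p <= 2 * n ^ e ->
  al < p -> size x = n ->
  outcome dyck2_algorithm 1 (space_bound n) (time_bound n) n p al x
    (accepted (run (hash_test p al) (block_size n) (Some ([::], [::])) x)).
Proof.
move=> e0 n0 /andP[p2 pn] alp sx.
have Bn := leq_block_size n0.
have nn : n <= n ^ (2 * e) by rewrite -{1}(expn1 n) leq_pexp2l //; lia.
have pp : p * p <= 4 * n ^ (2 * e).
  by rewrite mulnC mul2n -addnn expnD; nia.
by apply: dyck2_algorithm_outcome => //; rewrite /cell_bound; nia.
Qed.

End Bounds.

Section Asymptotics.
Local Open Scope classical_set_scope.
Local Open Scope ring_scope.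
Variables (R : realType) (e : nat).

(** Twice the cell bound is [2 ^ 7 * n ^ (2 * e)], hence at most [n ^ (2 * e + 7)] for [n >= 2]. *)
Lemma bitlen_cell_bound n : (1 < n)%N ->
  (bitlen (cell_bound e n))%:R <= (2 * e + 7)%:R / ln 2 * ln (n%:R : R).
Proof.
move=> n1.
have ln2 : 0 < ln (2 : R) by rewrite ln_gt0 // ltr1n.
have n0 : 0 < (n%:R : R) by rewrite ltr0n; lia.
rewrite mulrAC ler_pdivlMr // !mulr_natl -!lnXn //.
rewrite ler_ln ?posrE ?exprn_gt0 // -!natrX ler_nat.
have : (2 ^ trunc_log 2 (cell_bound e n) <= cell_bound e n)%N.
  by rewrite trunc_logP // /cell_bound muln_gt0 expn_gt0; lia.
rewrite /bitlen expnS /cell_bound expnD => H.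
have n7 : (2 ^ 7 <= n ^ 7)%N by rewrite leq_exp2r.
by have := leq_mul n7 (leqnn (n ^ (2 * e))%N); lia.
Qed.

Lemma block_size_sqrt n : (0 < n)%N ->
  (20 + 4 * block_size n)%:R <= 28 * Num.sqrt (n%:R : R).
Proof.
move=> n0; rewrite natrD natrM.
have s1 : 1 <= Num.sqrt (n%:R : R).
  by rewrite -[X in X <= _]sqrtr1 ler_sqrt ?ler1n.
have sB : (block_size n)%:R <= 2 * Num.sqrt (n%:R : R).
  rewrite -ler_sqr ?nnegrE ?mulr_ge0 ?sqrtr_ge0 // exprMn sqr_sqrtr //.
  by rewrite -!natrX -natrM ler_nat; exact: block_size_sq.
(* The constant 28 is [20 + 4 * 2], as the square root is at least 1. *)
lra.
Qed.

Lemma space_boundO : (fun n => (space_bound e n)%:R : R) =O_\oo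
  (fun n => Num.sqrt (n%:R : R) * ln (n%:R : R)).
Proof.
set K : R := (2 * e + 7)%:R / ln 2.
have ln2 : 0 < ln (2 : R) by rewrite ln_gt0 // ltr1n.
have K0 : 0 < K by rewrite divr_gt0 // ltr0n addnS.
apply/eqO_exP; exists (28 * K); first by rewrite mulr_gt0.
near=> n.
have n1 : (1 < n)%N by near: n; exact: nbhs_infty_ge.
have ln0 : 0 <= ln (n%:R : R) by rewrite ln_ge0 // ler1n; lia.
rewrite ger0_norm // ger0_norm ?mulr_ge0 ?sqrtr_ge0 //.
rewrite mulrACA /space_bound /space natrM.
by apply: ler_pM => //; [apply: block_size_sqrt; lia|exact: bitlen_cell_bound].
Unshelve. all: by end_near. Qed.

(** Of the three logarithmic factors, two come from the cost of an instruction and one from the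
    preprocessing loop. *)
Lemma time_bound_polylog : (0 < e)%N -> polylog R (time_bound e).
Proof.
move=> e0; exists 3.
set K : R := (2 * e + 7)%:R / ln 2.
have ln2 : 0 < ln (2 : R) by rewrite ln_gt0 // ltr1n.
have K0 : 0 < K by rewrite divr_gt0 // ltr0n addnS.
(* 208 is [2 * (4 + 100)], the number of turns and 1 both being at most the bit length. *)
apply/eqO_exP; exists (208 * K ^+ 3); first by rewrite mulr_gt0 ?exprn_gt0.
near=> n.
have n1 : (1 < n)%N by near: n; exact: nbhs_infty_ge.
have ln0 : 0 <= ln (n%:R : R) by rewrite ln_ge0 // ler1n; lia.
rewrite ger0_norm // ger0_norm ?exprn_ge0 // -mulrA -exprMn.
apply: (@le_trans _ _ ((208 * bitlen (cell_bound e n) ^ 3)%N%:R)).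
  rewrite ler_nat /time_bound /instr_time.
  have : (up_log 4 n <= bitlen (cell_bound e n))%N.
    apply: leq_trans (up_log_bitlen _) _; first lia.
    apply: leq_bitlen; rewrite /cell_bound.
    have : (n ^ 1 <= n ^ (2 * e))%N by rewrite leq_pexp2l; lia.
    by rewrite expn1; lia.
  by rewrite !expnS expn0; set W := bitlen _; have : (0 < W)%N by []; nia.
rewrite natrM natrX ler_pM2l //; apply: lerXn2r; rewrite ?nnegrE //.
  exact: mulr_ge0 (ltW K0) ln0.
exact: bitlen_cell_bound.
Unshelve. all: by end_near. Qed.

End Asymptotics.

Local Open Scope classical_set_scope.
Local Open Scope ring_scope.

Lemma good_prime_bounds (R : realType) (c : R) (n p : nat) :
  1 <= c -> good_prime c n p ->
  [/\ (0 < n)%N, prime p, (p <= 2 * n ^ (Num.trunc c).+2)%N &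
      n%:R / p%:R <= n%:R `^ (- c)].
Proof.
move=> c1 [pp /andP[np pn]].
have n0 : (0 < n)%N.
  (* For [n = 0] the interval for [p] would be empty, both of its ends being 0. *)
  rewrite lt0n; apply/eqP => n0; move: np pn; rewrite n0 powR0; last lra.
  by rewrite mulr0 => H1 H2; have := le_lt_trans H1 H2; rewrite ltxx.
have nR : 0 < n%:R :> R by rewrite ltr0n.
have pR : 0 < p%:R :> R by rewrite ltr0n prime_gt0.
split=> //.
  rewrite -(ler_nat R) natrM natrX; apply: (le_trans (ltW pn)).
  rewrite ler_pM2l // -(powR_mulrn _ (ltW nR)).
  apply: ler_powR; first by rewrite ler1n.
  (* The real exponent [1 + c] is rounded up to an integer, using [c < Num.trunc c + 1]. *)
  by rewrite -[X in _ <= X]natr1 addrC lerD2r ltW // truncnS_gt.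
rewrite powRN ler_pdivrMr // mulrC ler_pdivlMr ?powR_gt0 //.
apply: le_trans np; rewrite powRD; last by rewrite (gt_eqF nR) implybT.
by rewrite powRr1 // ltW.
Qed.

Lemma unif_prob_ge (R : realType) (p k : nat) (E : nat -> Prop)
    (bad : {set 'I_p}) : (0 < p)%N -> (#|bad| <= k)%N ->
  (forall al : 'I_p, al \notin bad -> E al) ->
  1 - k%:R / p%:R <= unif_prob R p E.
Proof.
move=> p0 bk HE; have pR : 0 < p%:R :> R by rewrite ltr0n.
rewrite /unif_prob ler_pdivlMr // mulrBl mul1r divfK ?gt_eqF //.
rewrite lerBlDr -natrD ler_nat.
apply: (@leq_trans (#|~: bad| + #|bad|)%N); first by rewrite addnC cardsC card_ord.
apply: leq_add => //; apply: subset_leq_card.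
apply/fintype.subsetP => al.
rewrite finset.inE => /HE Eal; rewrite inE; exact/asboolP.
Qed.

Theorem theorem1 (R : realType) (c : R) (hc : 1 <= c) :
  exists (A : algorithm) (s t : nat -> nat),
    [/\ streaming_algorithm c 1 s t A,
        (fun n => (s n)%:R : R) =O_\oo
          (fun n => Num.sqrt (n%:R : R) * ln (n%:R : R)),
        polylog R t
      & forall (n p : nat) (x : seq letter),
          good_prime c n p -> size x = n ->
          (dyck2 x ->
             unif_prob R p (fun alpha =>
               outcome A 1 (s n) (t n) n p alpha x true) = 1) /\
          (~ dyck2 x ->
             1 - n%:R `^ (- c) <=
             unif_prob R p (fun alpha =>
               outcome A 1 (s n) (t n) n p alpha x false))].
Proof.
set e := (Num.trunc c).+2.
exists dyck2_algorithm, (space_bound e), (time_bound e).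
have Hout n p al x : good_prime c n p -> (al < p)%N -> size x = n ->
    outcome dyck2_algorithm 1 (space_bound e n) (time_bound e n) n p al x
      (accepted (run (hash_test p al) (block_size n) (Some ([::], [::])) x)).
  move=> /(good_prime_bounds hc)[n0 pp pn _] alp sx.
  by apply: bounded_outcome => //; rewrite prime_gt1.
split.
- by move=> n p al x gp alp sx; eexists; exact: Hout.
- exact: space_boundO.
- exact: time_bound_polylog.
move=> n p x gp sx; have [n0 pp pn np] := good_prime_bounds hc gp.
set B := block_size n; have B0 : (0 < B)%N by rewrite expn_gt0.
have w0 : well_sized B ([::], [::]) by rewrite /well_sized /= B0.
have refl al s : hash_test p al s s by rewrite /hash_test eqxx.
have exactE : accepted (run eq_op B (Some ([::], [::])) x) = stack_accepts [::] x.
  by rewrite accepted_exact.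
split=> [/stack_acceptsP dx|/stack_acceptsP ndx].
  rewrite /unif_prob (_ : [set _ | _]%SET = [set: 'I_p]%SET).
    by rewrite cardsT card_ord divff // pnatr_eq0 -lt0n prime_gt0.
  apply/setP => al; rewrite !inE; apply/asboolP.
  have := Hout n p al x gp (ltn_ord al) sx.
  by rewrite accepted_complete // exactE.
(* The pair is fixed by the exact run, before [alpha] is considered, so one set of collisions
   contains all the bad values. *)
have [|o [c' [oc so sc Hw]]] := rejected_witness (w := x) B0 w0.
  by rewrite exactE.
apply: (@le_trans _ _ (1 - n%:R / p%:R)); first by rewrite lerD2l lerN2.
apply: (@unif_prob_ge _ _ _ _ [set al : 'I_p | hash_test p al o c']%SET).
- exact: prime_gt0.
- apply: leq_trans (ltnW (card_collisions pp oc _)) _; first by rewrite so sc.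
  by rewrite so leq_block_size.
move=> al; rewrite inE => nt.
have := Hout n p al x gp (ltn_ord al) sx.
by rewrite (negbTE (Hw _ (refl al) nt)).
Qed.
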